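(* For an arbitrary $w\in\mathbb{F}$ with $|w|>1$, the linear operator \[ \hat{A}_wz:=\left(w^{k+1}\frac{k+2}{k+1}\sum_{j=0}^{k+1}z_j-w^k\frac{k+1}{k}\sum_{j=0}^{k}z_j\right)_{k\in\mathbb{N}} \] with $z_0:=-\sum_{k=1}^\infty z_k$, in the space $l_1$ with domain \[ D(\hat{A}_w):=\left\{z:=(z_k)_{k\in\mathbb{N}}\in l_1\ \middle|\ \left(w^k(k+1)\sum_{j=0}^{k}z_j\right)_{k\in\mathbb{N}}\in X\right\} \] is unbounded and chaotic as well as its every power \[ \hat{A}_w^{\,n}z=\left(\left[\prod_{m=k}^{k-1+n}w^m\right]\left(w^n\frac{k+1+n}{k+1}\sum_{j=0}^{k+n}z_j-\frac{k+n}{k}\sum_{j=0}^{k-1+n}z_j\right)\right)_{k\in\mathbb{N}},\quad n\in\mathbb{N}, \] with $z_0:=-\sum_{k=1}^\infty z_k$, and domain \[ D(\hat{A}_w^{\,n})=\left\{z:=(z_k)_{k\in\mathbb{N}}\in l_1\ \middle|\ \left(\left[\prod_{m=k}^{k+n-1}w^m\right](k+n)\sum_{j=0}^{k-1+n}z_j\right)_{k\in\mathbb{N}}\in X\right\}. \] Furthermore, each $\lambda\in\mathbb{F}$ is an eigenvalue for $\hat{A}_w$ of geometric multiplicity $1$, i.e., \[ \dim\ker(\hat{A}_w-\lambda I)=1. \] In particular, provided the space $l_1$ is complex (i.e., $\mathbb{F}=\mathbb{C}$), $\sigma_p(\hat{A}_w)=\mathbb{C}$.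
   Context: $\mathbb{F}:=\mathbb{R}$ or $\mathbb{F}:=\mathbb{C}$; $\mathbb{N}=\{1,2,3,\dots\}$, $\mathbb{Z}_+=\{0,1,2,\dots\}$; $l_1$ is the Banach space over $\mathbb{F}$ of absolutely summable sequences $(z_k)_{k\in\mathbb{N}}\in\mathbb{F}^{\mathbb{N}}$ with the norm $\|z\|_1=\sum_{k=1}^\infty|z_k|$. $X$ is the sequence space over $\mathbb{F}$ \[ X:=\Big\{(x_k)_{k\in\mathbb{N}}\in\mathbb{F}^{\mathbb{N}}\ \Big|\ \sum_{k=1}^\infty\Big|\frac{x_{k+1}}{k+1}-\frac{x_k}{k}\Big|<\infty\ \text{and}\ \lim_{k\to\infty}\frac{x_k}{k}=0\Big\}. \] For a (bounded or unbounded) linear operator $A$ in a (real or complex) Banach space $E$ with domain $D(A)$, powers $A^n$ have their natural domains ($D(A^{n+1})=\{x\in D(A^n)\mid A^nx\in D(A)\}$), $A^0:=I$, and $C^\infty(A):=\bigcap_{n=0}^\infty D(A^n)$. A nonzero vector $x\in C^\infty(A)$ is hypercyclic for $A$ if its orbit $\{A^nx\}_{n\in\mathbb{Z}_+}$ is dense in $E$; $A$ is hypercyclic if it has a hypercyclic vector. A vector $x\in D(A^N)$ with $A^Nx=x$ for some $N\in\mathbb{N}$ is a periodic point of $A$. $A$ is chaotic if it is hypercyclic and its set of periodic points is dense in $E$. For a closed linear operator $A$ in a complex Banach space, the point spectrum $\sigma_p(A)$ is the set of $\lambda\in\mathbb{C}$ for which $A-\lambda I$ is not injective (the eigenvalues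 of $A$). *)

(* Defs.v *)
From HB Require Import structures.
From mathcomp Require Import all_boot all_order all_algebra.
From mathcomp Require Import all_classical all_reals all_analysis.
From mathcomp Require Import complex.

Set Implicit Arguments.
Unset Strict Implicit.
Unset Printing Implicit Defensive.

Import Order.TTheory GRing.Theory Num.Theory.
Import numFieldNormedType.Exports.

Local Open Scope classical_set_scope.
Local Open Scope ring_scope.

Definition is_complex_field (F : numFieldType) : Prop :=
  exists R : realType, F = R[i] :> numFieldType.

Definition real_or_complex (F : numFieldType) : Prop :=
  (exists R : realType, F = R :> numFieldType) \/ is_complex_field F.

Lemma cauchy_cvgn (F : numFieldType) (hF : real_or_complex F) (u : nat -> F) :
  cauchy (u @ \oo) -> cvgn u.
Proof.
case: hF => -[R eF]; subst F; first exact: cauchy_cvg.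
move=> /cauchyP cu.
have part (f : R[i] -> R) : (forall x y, f (x - y) = f x - f y) ->
    (forall x : R[i], (`|f x|%:C <= `|x|)%C) -> cvgn (f \o u).
  move=> fB fle; apply/cauchy_cvgP/cauchyP => e e0.
  have eC0 : 0 < e%:C%C by rewrite ltcR.
  have [x ux] := cu _ eC0; exists (f x).
  suff : \oo (fun n => ball (f x) e (f (u n))) by [].
  have {}ux : \oo (fun n => ball x e%:C%C (u n)) by [].
  apply: filterS ux => n.
  rewrite -!ball_normE /= -fB => xy.
  by rewrite -ltcR; apply: le_lt_trans xy; apply: fle.
have cRe : cvgn (@complex.Re R \o u).
  apply: part; first by case=> [a b] [c d].
  exact: normc_ge_Re.
have cIm : cvgn (@complex.Im R \o u).
  apply: part; first by case=> [a b] [c d].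
  case=> a b; rewrite normc_def lecR /= -sqrtr_sqr ler_wsqrtr//.
  by rewrite lerDr sqr_ge0.
pose l : R[i] := Complex (limn (@complex.Re R \o u)) (limn (@complex.Im R \o u)).
apply/cvg_ex; exists l; apply/cvgrPdist_lt => e e0.
have eR : e = (complex.Re e)%:C%C by rewrite RRe_real// gtr0_real.
have e20 : 0 < complex.Re e / 2 by rewrite divr_gt0// -ltcR -eR.
move/cvgrPdist_lt : cRe => /(_ _ e20) cRe.
move/cvgrPdist_lt : cIm => /(_ _ e20) cIm.
near=> n.
have -> : l - u n = (complex.Re (l - u n))%:C%C
                    + 'i%C * (complex.Im (l - u n))%:C%C by rewrite -complexE.
apply: le_lt_trans (ler_normD _ _) _.
have -> : `|'i%C * (complex.Im (l - u n))%:C%C| = `|(complex.Im (l - u n))%:C%C|.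
  rewrite normrM [X in X * _](_ : _ = 1) ?mul1r// normc_def /=.
  by rewrite !expr2 mulr0 mulr1 add0r sqrtr1.
have normR (x : R) : `|x%:C%C| = `|x|%:C%C :> R[i].
  by rewrite normc_def /= expr0n addr0 sqrtr_sqr.
have -> : e = (complex.Re e / 2)%:C%C + (complex.Re e / 2)%:C%C.
  by rewrite -rmorphD /= -splitr -eR.
rewrite !normR; apply: ltrD; rewrite ltcR.
  have -> : complex.Re (l - u n) = limn (@complex.Re R \o u) - complex.Re (u n).
    by rewrite /l; case: (u n).
  by near: n.
have -> : complex.Im (l - u n) = limn (@complex.Im R \o u) - complex.Im (u n).
  by rewrite /l; case: (u n).
by near: n.
Unshelve. all: by end_near. Qed.

(* A sequence (u_k) indexed by {1, 2, 3, ...} is a function [u : nat -> F] of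
   which only the values [u k], 0 < k, are meaningful. *)

Definition abs_summable (F : numFieldType) (u : nat -> F) : Prop :=
  cvgn [series `|u k.+1|]_k.

Definition sum_from1 (F : numFieldType) (u : nat -> F) : F :=
  limn [series u k.+1]_k.

Section summability.
Context (F : numFieldType) (hF : real_or_complex F).
Implicit Types u v : nat -> F.

Lemma abs_summable_le u v :
  (forall k, (0 < k)%N -> `|u k| <= `|v k|) ->
  abs_summable v -> abs_summable u.
Proof.
move=> uv /cvg_cauchy /cauchy_seriesP cv; apply: (cauchy_cvgn hF).
apply/cauchy_seriesP => e /cv; apply: filterS => n /=.
apply: le_lt_trans; rewrite !ger0_norm ?sumr_ge0//.
by apply: ler_sum => k _; apply: uv.
Qed.

Lemma abs_summable_lin (a : F) u v :
  abs_summable u -> abs_summable v -> abs_summable (a *: u + v).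
Proof.
move=> su sv.
pose w k := `|a| * `|u k| + `|v k|.
apply: (@abs_summable_le _ w) => [k _|].
  rewrite [leRHS]ger0_norm ?addr_ge0 ?mulr_ge0//.
  by apply: le_trans (ler_normD _ _) _; rewrite normrM.
rewrite /abs_summable.
have -> : [series `|w k.+1|]_k
    = (fun n => `|a| * [series `|u k.+1|]_k n + [series `|v k.+1|]_k n).
  apply/funext => n; rewrite /series /= mulr_sumr -big_split /=.
  by apply: eq_bigr => k _; rewrite ger0_norm ?addr_ge0 ?mulr_ge0.
apply: is_cvgD sv.
by apply: is_cvgM su; exact: is_cvg_cst.
Qed.

Lemma abs_summable_cvg u : abs_summable u -> cvgn [series u k.+1]_k.
Proof.
move=> /cvg_cauchy /cauchy_seriesP cu; apply: (cauchy_cvgn hF).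
apply/cauchy_seriesP => e /cu; apply: filterS => n /=.
by apply: le_lt_trans; rewrite [leRHS]ger0_norm ?sumr_ge0// ler_norm_sum.
Qed.

Lemma sum_from1_lin (a : F) u v : abs_summable u -> abs_summable v ->
  sum_from1 (a *: u + v) = a * sum_from1 u + sum_from1 v.
Proof.
move=> /abs_summable_cvg cu /abs_summable_cvg cv; rewrite /sum_from1.
have -> : [series (a *: u + v) k.+1]_k
    = (fun n => a * [series u k.+1]_k n + [series v k.+1]_k n).
  by apply/funext => n; rewrite /series /= mulr_sumr -big_split.
apply: cvg_lim => //; apply: cvgD => //; apply: cvgM => //; exact: cvg_cst.
Qed.

End summability.

(* The space l_1; the meaningless entry at index 0 is fixed to 0, so that
   equality in [l1 hF] is equality of the sequences indexed by {1, 2, ...}.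
   The hypothesis [hF] (completeness of F) is what makes it a normed space. *)

Definition l1_pred (F : numFieldType) (hF : real_or_complex F) :
    {pred nat -> F} :=
  [pred u : nat -> F | `[< u 0%N = 0 /\ abs_summable u >]].

Section l1_closed.
Context (F : numFieldType) (hF : real_or_complex F).

Fact l1_submod_closed : submod_closed (l1_pred hF).
Proof.
split.
  apply/asboolP; split=> //; rewrite /abs_summable.
  rewrite (_ : [series _]_k = cst 0); first exact: is_cvg_cst.
  by apply/funext => n; rewrite /series /= big1// => k _; rewrite normr0.
move=> a u v /asboolP[u0 su] /asboolP[v0 sv]; apply/asboolP; split.
  by rewrite !fctE u0 v0 scaler0 addr0.
exact: abs_summable_lin.
Qed.

HB.instance Definition _ :=
  GRing.isSubmodClosed.Build F (nat -> F) (l1_pred hF) l1_submod_closed.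

End l1_closed.

Record l1 (F : numFieldType) (hF : real_or_complex F) : Type := L1 {
  l1_entry :> nat -> F;
  l1_entryP : l1_entry \in l1_pred hF
}.

Section l1_space.
Context (F : numFieldType) (hF : real_or_complex F).
Local Notation l1 := (l1 hF).
Implicit Types z : l1.

HB.instance Definition _ := [isSub for @l1_entry F hF].
HB.instance Definition _ := [Choice of l1 by <:].
HB.instance Definition _ := [SubChoice_isSubLmodule of l1 by <:].

Lemma l1_summable z : abs_summable z.
Proof. by have /asboolP[] := l1_entryP z. Qed.

Lemma l1_at0 z : z 0%N = 0.
Proof. by have /asboolP[] := l1_entryP z. Qed.

Definition l1_norm z : F := sum_from1 (fun k => `|z k|).

Lemma numfield_limn_ge0 (u : nat -> F) : cvgn u -> (forall n, 0 <= u n) -> 0 <= limn u.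
Proof.
move=> cu u0; have e : (fun n => `|u n|) = u.
  by apply/funext => n; rewrite ger0_norm.
by rewrite -e (lim_norm cu) normr_ge0.
Qed.

Lemma numfield_limn_le (u v : nat -> F) : cvgn u -> cvgn v ->
  (forall n, u n <= v n) -> limn u <= limn v.
Proof.
move=> cu cv uv; rewrite -subr_ge0 -limB//.
by apply: numfield_limn_ge0; [exact: is_cvgB|move=> n; rewrite subr_ge0; exact: uv].
Qed.

Fact l1_normD z1 z2 : l1_norm (z1 + z2) <= l1_norm z1 + l1_norm z2.
Proof.
rewrite /l1_norm /sum_from1 -limD; try exact: l1_summable.
apply: numfield_limn_le; first exact: l1_summable.
  by apply: is_cvgD; exact: l1_summable.
move=> n.
apply: (@le_trans _ _ (\sum_(0 <= k < n) (`|z1 k.+1| + `|z2 k.+1|))).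
  by apply: ler_sum => k _; exact: ler_normD.
by rewrite big_split.
Qed.

Fact l1_normZ (a : F) z : l1_norm (a *: z) = `|a| * l1_norm z.
Proof.
rewrite /l1_norm /sum_from1.
have -> : [series `|(a *: z) k.+1|]_k
        = (fun n => `|a| * [series `|z k.+1|]_k n).
  apply/funext => n; rewrite /series /= mulr_sumr.
  by apply: eq_bigr => k _; rewrite -normrM.
apply: cvg_lim => //; apply: cvgM; first exact: cvg_cst.
exact: l1_summable.
Qed.

Fact l1_norm_eq0 z : l1_norm z = 0 -> z = 0.
Proof.
move=> z0; apply: val_inj; apply/funext => -[|k] /=; first exact: l1_at0.
have : `|z k.+1| <= 0.
  rewrite -z0 /l1_norm /sum_from1 -subr_ge0.
  set S := [series `|z j.+1|]_j.
  have cS : (fun n => S (n + k.+1)%N - `|z k.+1|) @ \oo --> limn S - `|z k.+1|.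
    apply: cvgB; last exact: cvg_cst.
    by rewrite (cvg_shiftn k.+1 S); exact: l1_summable.
  rewrite -(cvg_lim _ cS)//; apply: numfield_limn_ge0; first by apply/cvg_ex; eexists; exact: cS.
  move=> n; rewrite subr_ge0 /S /series /= (bigD1_seq k) ?iota_uniq//=.
    by rewrite lerDl sumr_ge0.
  by rewrite mem_index_iota addnS ltnS leq_addl.
by rewrite normr_le0 => /eqP.
Qed.

HB.instance Definition _ :=
  @Lmodule_isNormed.Build F l1 l1_norm l1_normD l1_normZ l1_norm_eq0.

Lemma l1_normE z : `|z| = sum_from1 (fun k => `|z k|).
Proof. by []. Qed.

(* (z_0, z_1, z_2, ...) with z_0 := - \sum_(k >= 1) z_k *)
Definition l1_ext z (j : nat) : F :=
  if j is 0 then - sum_from1 z else z j.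

(* The sequence [u] as an element of l_1; junk value 0 if u is not summable. *)
Definition l1_of (u : nat -> F) : l1 :=
  insubd (0 : l1) (fun k => if k is 0 then 0 else u k).

Lemma l1_ofE u k : abs_summable u -> (0 < k)%N -> l1_of u k = u k.
Proof.
move=> su k0; rewrite /l1_of -[LHS]/(val (insubd _ _) k) insubdK; first by case: k k0.
by apply/asboolP; split.
Qed.

Lemma l1_eq z1 z2 : (forall k, (0 < k)%N -> z1 k = z2 k) -> z1 = z2.
Proof.
move=> e; apply: val_inj; apply/funext => -[|k]; last exact: e.
by rewrite /= (l1_at0 z1) (l1_at0 z2).
Qed.

Lemma l1_ext_lin (a : F) z1 z2 j :
  l1_ext (a *: z1 + z2) j = a * l1_ext z1 j + l1_ext z2 j.
Proof.
case: j => [|j] //=; rewrite mulrN -opprD; congr (- _).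
exact: (sum_from1_lin hF a (@l1_summable z1) (@l1_summable z2)).
Qed.

Lemma sum_l1_ext_lin (a : F) z1 z2 n :
  \sum_(0 <= j < n) l1_ext (a *: z1 + z2) j
  = a * (\sum_(0 <= j < n) l1_ext z1 j) + \sum_(0 <= j < n) l1_ext z2 j.
Proof.
by rewrite mulr_sumr -big_split; apply: eq_bigr => j _; exact: l1_ext_lin.
Qed.

End l1_space.

Definition space_X (F : numFieldType) : set (nat -> F) :=
  [set x | abs_summable (fun k => x k.+1 / k.+1%:R - x k / k%:R)
           /\ (fun k => x k / k%:R) @ \oo --> (0 : F)].
Arguments space_X : clear implicits.

Lemma space_X_lin (F : numFieldType) (hF : real_or_complex F) (a : F)
  (x y : nat -> F) : space_X F x -> space_X F y -> space_X F (a *: x + y).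
Proof.
move=> [sx cx] [sy cy]; split.
  apply: (@abs_summable_le F hF _ _ _ (@abs_summable_lin F hF a _ _ sx sy)) => k _.
  rewrite -[(a *: x + y) k.+1]/(a * x k.+1 + y k.+1).
  rewrite -[(a *: x + y) k]/(a * x k + y k).
  by rewrite !mulrDl opprD addrACA -!mulrA -mulrBr.
have -> : (fun k => (a *: x + y) k / k%:R)
    = (fun k => a * (x k / k%:R) + y k / k%:R).
  by apply/funext => k; rewrite !fctE mulrDl mulrA.
rewrite -[X in _ --> X]addr0 -{1}(mulr0 a).
by apply: cvgD => //; apply: cvgM => //; exact: cvg_cst.
Qed.

(* Linear operators defined on a subspace [dom A]; the values of [A] outside
   [dom A] carry no information. *)
Record lin_op (F : numFieldType) (E : lmodType F) := LinOp {
  dom : set E;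
  op_fun :> E -> E;
  dom0 : dom 0;
  dom_lin : forall (a : F) x y, dom x -> dom y -> dom (a *: x + y);
  op_lin : forall (a : F) x y, dom x -> dom y ->
    op_fun (a *: x + y) = a *: op_fun x + op_fun y
}.

Section operators.
Context (F : numFieldType) (E : lmodType F).
Implicit Types (A : lin_op E).

Fixpoint pow_dom A (n : nat) : set E :=
  if n is m.+1 then [set x | pow_dom A m x /\ dom A (iter m A x)] else setT.

Lemma pow_lin A n a x y : pow_dom A n x -> pow_dom A n y ->
  pow_dom A n (a *: x + y) /\ iter n A (a *: x + y) = a *: iter n A x + iter n A y.
Proof.
elim: n => [//|n IH] /= [xn xd] [yn yd].
have [pn ->] := IH xn yn.
by split; [split=> //; exact: dom_lin|rewrite op_lin].
Qed.

Lemma pow0 A n : pow_dom A n 0 /\ iter n A 0 = 0.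
Proof.
have A0 : A 0 = 0.
  have := op_lin (-1) (dom0 A) (dom0 A).
  by rewrite scaler0 add0r scaleN1r addNr.
by elim: n => [//|n [pn e]] /=; rewrite e; split=> //; split=> //; exact: dom0.
Qed.

Definition op_pow A n : lin_op E :=
  @LinOp F E (pow_dom A n) (iter n A) (pow0 A n).1
    (fun a x y hx hy => (pow_lin a hx hy).1)
    (fun a x y hx hy => (pow_lin a hx hy).2).

Fact op_shift_lin A (lambda a : F) x y : dom A x -> dom A y ->
  A (a *: x + y) - lambda *: (a *: x + y)
  = a *: (A x - lambda *: x) + (A y - lambda *: y).
Proof.
move=> hx hy; rewrite op_lin// scalerDr opprD addrACA scalerBr.
by rewrite !scalerA mulrC.
Qed.

(* A - lambda I *)
Definition op_shift A (lambda : F) : lin_op E :=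
  @LinOp F E (dom A) (fun x => A x - lambda *: x) (dom0 A) (@dom_lin F E A)
    (@op_shift_lin A lambda).

Definition op_ker A : set E := [set x | dom A x /\ A x = 0].

Definition point_spectrum A : set F :=
  [set lambda | ~ set_inj (dom A) (op_shift A lambda)].

(* The subspace S has a basis with n elements. *)
Definition has_dim (S : set E) (n : nat) : Prop :=
  exists b : 'I_n -> E,
    (forall c : 'I_n -> F, \sum_i c i *: b i = 0 -> forall i, c i = 0) /\
    S = range (fun c : 'I_n -> F => \sum_i c i *: b i).

Definition C_infty A : set E := \bigcap_(n in setT) dom (op_pow A n).

Definition periodic_points A : set E :=
  [set x | exists N, [/\ (0 < N)%N, dom (op_pow A N) x & op_pow A N x = x]].

End operators.

Section dynamics.
Context (F : numFieldType) (E : normedModType F).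
Implicit Types (A : lin_op E).

Definition bounded_op A : Prop :=
  exists M : F, forall x, dom A x -> `|A x| <= M * `|x|.

Definition unbounded_op A : Prop := ~ bounded_op A.

Definition hypercyclic_vector A (x : E) : Prop :=
  [/\ x != 0, C_infty A x & dense (range (fun n => op_pow A n x))].

Definition hypercyclic A : Prop := exists x, hypercyclic_vector A x.

Definition chaotic A : Prop := hypercyclic A /\ dense (periodic_points A).

End dynamics.

Section hatA.
Context (F : numFieldType) (hF : real_or_complex F) (w : F).
Implicit Types z : l1 hF.

Definition hatA_dom : set (l1 hF) :=
  [set z | space_X F (fun k =>
    w ^+ k * k.+1%:R * \sum_(0 <= j < k.+1) l1_ext z j)].

Definition hatA_seq z (k : nat) : F :=
  w ^+ k.+1 * (k.+2%:R / k.+1%:R) * (\sum_(0 <= j < k.+2) l1_ext z j)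
  - w ^+ k * (k.+1%:R / k%:R) * (\sum_(0 <= j < k.+1) l1_ext z j).

Definition hatA_fun z : l1 hF := l1_of hF (hatA_seq z).

Lemma hatA_summable z : hatA_dom z -> abs_summable (hatA_seq z).
Proof.
move=> [sx _]; apply: (@abs_summable_le F hF _ _ _ sx) => k _.
by rewrite /hatA_seq !mulrA -!(mulrAC _ _^-1).
Qed.

Lemma hatA_funE z k : hatA_dom z -> (0 < k)%N -> hatA_fun z k = hatA_seq z k.
Proof. by move=> /hatA_summable; exact: l1_ofE. Qed.

Fact hatA_dom_lin (a : F) z1 z2 :
  hatA_dom z1 -> hatA_dom z2 -> hatA_dom (a *: z1 + z2).
Proof.
move=> d1 d2; rewrite /hatA_dom /=.
have := space_X_lin hF a d1 d2; congr (space_X F _).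
by apply/funext => k; rewrite !fctE sum_l1_ext_lin mulrDr mulrCA.
Qed.

Fact hatA_dom0 : hatA_dom 0.
Proof.
have ext0 j : l1_ext (0 : l1 hF) j = 0.
  have := @l1_ext_lin F hF (-1) 0 0 j.
  by rewrite scaler0 add0r mulN1r addNr.
have z0 : (fun k => w ^+ k * k.+1%:R *
    \sum_(0 <= j < k.+1) l1_ext (0 : l1 hF) j) = (0 : nat -> F).
  by apply/funext => k; rewrite big1 ?mulr0.
rewrite /hatA_dom /= z0; split.
  rewrite /abs_summable (_ : [series _]_k = cst 0); first exact: is_cvg_cst.
  by apply/funext => n; rewrite /series /= big1// => k _; rewrite !mul0r subr0 normr0.
rewrite (_ : (fun k => _) = cst 0); first exact: cvg_cst.
by apply/funext => k; rewrite mul0r.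
Qed.

Fact hatA_lin (a : F) z1 z2 : hatA_dom z1 -> hatA_dom z2 ->
  hatA_fun (a *: z1 + z2) = a *: hatA_fun z1 + hatA_fun z2.
Proof.
move=> d1 d2; apply: l1_eq => k k0.
have -> : (a *: hatA_fun z1 + hatA_fun z2 : l1 hF) k
    = a * hatA_fun z1 k + hatA_fun z2 k by [].
rewrite !hatA_funE//; last exact: hatA_dom_lin.
rewrite /hatA_seq !sum_l1_ext_lin !mulrDr opprD addrACA mulrN.
by rewrite !(mulrCA a).
Qed.

Definition hatA : lin_op (l1 hF) :=
  LinOp hatA_dom0 hatA_dom_lin hatA_lin.

End hatA.

(* Main.v *)
(* In the coordinates y_k = w^(k choose 2) * k * S_k, where S_k = z_0 + ... + z_(k-1),
   the operator becomes the plain backward shift (y_k) |-> (y_(k+1)), and l_1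
   corresponds to the y for which S has bounded variation and tends to 0.  As
   w^(k choose 2) outgrows every geometric sequence, every y of at most
   exponential growth is the coordinate sequence of a vector in the domain of
   all powers.  Hence y_k = lambda^(k-1) gives eigenvectors, periodic y give
   periodic points, and a sequence y listing finite sequences over a countable
   dense set of scalars in ever longer blocks gives a hypercyclic vector; since
   the block starting at index N has length N, what follows it contributes only
   O(2^-N) after N shifts. *)

Require Import Defs.
From mathcomp Require Import all_boot all_order all_algebra.
From mathcomp Require Import all_classical all_reals all_analysis.
From mathcomp Require Import complex ring lra zify.

Set Implicit Arguments.
Unset Strict Implicit.
Unset Printing Implicit Defensive.

Import Order.TTheory GRing.Theory Num.Theory.
Import numFieldNormedType.Exports.

Local Open Scope classical_set_scope.
Local Open Scope ring_scope.

(** * Archimedean scalars *)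

Section archimedean_scalars.
Context (F : numFieldType) (hF : real_or_complex F).

(** The Archimedean property, separability and completeness are the facts proved separately for the
    reals and the complex numbers; the rest is uniform in [F]. *)
Lemma scalar_archi (x : F) : exists n : nat, `|x| < n%:R.
Proof.
case: hF => -[R eF]; subst F.
  by exists (Num.Def.archi_bound `|x|); exact: archi_boundP.
have e : `|x| = (complex.Re `|x|)%:C%C by rewrite RRe_real// normr_real.
exists (Num.Def.archi_bound (complex.Re `|x|)).
rewrite e -(rmorph_nat (real_complex R)) /= ltcR.
by apply: archi_boundP; rewrite -lecR -e; exact: normr_ge0.
Qed.

Lemma scalar_separable :
  exists d : nat -> F, forall (x e : F), 0 < e -> exists n, `|x - d n| < e.
Proof.
have real_sep (R : realType) (x e : R) : 0 < e ->
    exists q : rat, `|x - ratr q| < e.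
  move=> e0; have /rat_in_itvoo[q] : x - e < x + e by lra.
  rewrite in_itv /= => /andP[h1 h2]; exists q.
  by rewrite ltr_norml; apply/andP; split; lra.
case: hF => -[R eF]; subst F.
  exists (fun n => ratr (odflt 0 (unpickle n : option rat))) => x e /real_sep.
  by move=> /(_ x)[q xq]; exists (pickle q); rewrite pickleK.
exists (fun n => let p := odflt (0, 0) (unpickle n : option (rat * rat)) in
                 Complex (ratr p.1) (ratr p.2)) => x e e0.
have eR : e = (complex.Re e)%:C%C by rewrite RRe_real// gtr0_real.
have e20 : 0 < complex.Re e / 2 by rewrite divr_gt0// -ltcR -eR.
have [p xp] := real_sep _ (complex.Re x) _ e20.
have [q xq] := real_sep _ (complex.Im x) _ e20.
exists (pickle (p, q)); rewrite pickleK /=.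
case: x xp xq => a b /= ap bq.
(* The complex modulus is at most the sum of the moduli of the real and imaginary parts. *)
rewrite eR; apply: le_lt_trans (_ : (`|a - ratr p| + `|b - ratr q|)%:C%C < _).
  rewrite normc_def lecR /=.
  rewrite -[leRHS]ger0_norm ?addr_ge0// -[leRHS]sqrtr_sqr ler_wsqrtr//.
  rewrite -(real_normK (num_real (a - ratr p))).
  rewrite -(real_normK (num_real (b - ratr q))) sqrrD.
  by rewrite lerD2r lerDl mulrn_wge0// mulr_ge0.
by rewrite ltcR [ltRHS]splitr ltrD.
Qed.

(** Bernoulli's inequality gives linear growth of the powers, and the Archimedean property does the
    rest. *)
Lemma expr_unbounded (q M : F) : 1 < q -> exists n, `|M| < q ^+ n.
Proof.
move=> q1; have h0 : 0 < q - 1 by rewrite subr_gt0.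
have bern n : 1 + n%:R * (q - 1) <= q ^+ n.
  elim: n => [|n IH]; first by rewrite mul0r addr0 expr0.
  rewrite exprS; apply: le_trans (ler_wpM2l (ltW (lt_trans ltr01 q1)) IH).
  rewrite -subr_ge0.
  have -> : q * (1 + n%:R * (q - 1)) - (1 + n.+1%:R * (q - 1))
          = n%:R * (q - 1) ^+ 2 by rewrite -[n.+1]addn1 natrD; ring.
  by rewrite mulr_ge0// exprn_ge0// ltW.
have [n Mn] := scalar_archi (`|M| / (q - 1)); exists n.
apply: lt_le_trans (bern n).
rewrite ger0_norm ?divr_ge0 ?(ltW h0)// ltr_pdivrMr// in Mn.
by rewrite ltr_wpDl.
Qed.

Lemma exprV_small (q e : F) : 1 < q -> 0 < e ->
  exists n, forall m, (n <= m)%N -> q ^- m < e.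
Proof.
move=> q1 e0; have [n en] := expr_unbounded (e^-1) q1.
exists n => m nm; rewrite -[e]invrK ltf_pV2 ?posrE ?invr_gt0//; last first.
  by rewrite exprn_gt0// (lt_trans ltr01).
rewrite gtr0_norm ?invr_gt0// in en; apply: lt_le_trans en _.
by apply: ler_weXn2l nm; exact: ltW.
Qed.

Lemma geometric_summable (q : F) : 1 < q -> abs_summable (fun k => q ^- k).
Proof.
move=> q1; have q0 : 0 < q := lt_trans ltr01 q1.
rewrite /abs_summable.
have -> : [series `|q ^- k.+1|]_k = series (geometric q^-1 q^-1).
  congr series; apply/funext => k.
  by rewrite /= ger0_norm ?invr_ge0 ?exprn_ge0 ?(ltW q0)// exprS invfM exprVn.
rewrite geometric_seriesE; last by rewrite lt_eqF// invf_lt1.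
apply: is_cvgM; last exact: is_cvg_cst.
apply: is_cvgM; first exact: is_cvg_cst.
apply: is_cvgB; first exact: is_cvg_cst.
apply/cvg_ex; exists 0; apply/cvgrPdist_lt => e e0.
have [n en] := exprV_small q1 e0.
near=> m; rewrite sub0r normrN ger0_norm ?exprn_ge0 ?invr_ge0 ?(ltW q0)//.
by rewrite exprVn; apply: en; near: m; exact: nbhs_infty_ge.
Unshelve. all: by end_near. Qed.

(** Consecutive gauges have ratio |w|^k, which exceeds r from some n on, so the bound propagates by
    induction; up to n the constant (1 + r)^n covers r^k. *)
Lemma gauge_dominates (w : F) (r : F) : 1 < `|w| -> 0 <= r ->
  exists2 C : F, 0 <= C & forall k, r ^+ k <= C * `|w ^+ 'C(k, 2)|.
Proof.
move=> w1 r0; have w0 : 0 < `|w| := lt_trans ltr01 w1.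
have [n nr] := expr_unbounded r w1; rewrite ger0_norm// in nr.
exists ((1 + r) ^+ n); first by rewrite exprn_ge0// addr_ge0.
have G1 k : 1 <= `|w ^+ 'C(k, 2)| by rewrite normrX exprn_ege1// ltW.
elim=> [|k IH].
  rewrite expr0 -[leLHS]mulr1; apply: ler_pM => //.
  by apply: exprn_ege1; rewrite lerDl.
have [kn|kn] := ltnP k n.
  rewrite -[leLHS]mulr1; apply: ler_pM => //; first exact: exprn_ge0.
  apply: (@le_trans _ _ ((1 + r) ^+ k.+1)).
    by apply: lerXn2r; rewrite ?nnegrE ?addr_ge0// lerDr.
  by apply: ler_weXn2l => //; rewrite lerDl.
rewrite binS bin1 exprD normrM mulrA exprSr ler_pM ?exprn_ge0//.
apply: le_trans (ltW nr) _; rewrite normrX.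
by apply: ler_weXn2l => //; exact: ltW.
Qed.

End archimedean_scalars.

(** * Sequences of bounded variation tending to 0 *)

(** With S_k = x_k / k this is the condition defining [space_X]. The vectors of l_1 are the
    increments of such sequences, so the space and the domains are both expressed through it. *)
Definition bv0 (F : numFieldType) (S : nat -> F) : Prop :=
  abs_summable (fun k => S k.+1 - S k) /\ S @ \oo --> (0 : F).

Section partial_sums.
Context (F : numFieldType) (hF : real_or_complex F).
Implicit Types (S u v : nat -> F) (z : l1 hF).

Lemma space_X_bv0 (x : nat -> F) : space_X F x <-> bv0 (fun k => x k / k%:R).
Proof. by []. Qed.

Lemma eq_abs_summable u v : (forall k, (0 < k)%N -> u k = v k) ->
  abs_summable u -> abs_summable v.
Proof. by move=> uv; apply: (abs_summable_le hF) => k k0; rewrite uv. Qed.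

Lemma eq_bv0 u v : (forall k, (0 < k)%N -> u k = v k) -> bv0 u -> bv0 v.
Proof.
move=> uv [su cu]; split; first by apply: eq_abs_summable su => k k0; rewrite !uv.
apply: cvg_trans cu; apply: near_eq_cvg; near=> k; apply: uv.
by near: k; exact: nbhs_infty_gt.
Unshelve. all: by end_near. Qed.

Lemma abs_summable_bv0 u : abs_summable u -> bv0 u.
Proof.
move=> su; have cu : u @ \oo --> (0 : F).
  by rewrite -cvg_shiftS; apply: cvg_series_cvg_0; exact: (abs_summable_cvg hF su).
split=> //; have su1 : abs_summable (fun k => u k.+1).
  move: su; rewrite /abs_summable => /cvg_ex[l ul]; apply/cvg_ex.
  exists (l - `|u 1%N|).
  have -> : [series `|u k.+2|]_k
      = (fun n => [series `|u k.+1|]_k n.+1 - `|u 1%N|).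
    by apply/funext => n; rewrite /series /= big_nat_recl//= addrAC subrr add0r.
  by apply: cvgB (cvg_cst _); rewrite cvg_shiftS.
apply: (eq_abs_summable (u := (-1) *: u + (fun k => u k.+1))).
  by move=> k _; rewrite !fctE scaleN1r addrC.
exact: abs_summable_lin.
Qed.

Lemma bv0_lin (a : F) u v : bv0 u -> bv0 v -> bv0 (a *: u + v).
Proof.
move=> [su cu] [sv cv]; split.
  apply: (eq_abs_summable
    (u := a *: (fun k => u k.+1 - u k) + (fun k => v k.+1 - v k))).
    by move=> k _; rewrite !fctE scalerBr opprD addrACA.
  exact: abs_summable_lin.
rewrite -[X in _ --> X]addr0 -{1}(mulr0 a).
by apply: cvgD cv; apply: cvgM cu; exact: cvg_cst.
Qed.

Lemma geometric_abs_summable u (C q : F) : 1 < q ->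
  (forall k, `|u k| <= C * q ^- k) -> abs_summable u.
Proof.
move=> q1 uC.
have sq := geometric_summable hF q1.
(* The majorant C q^-k is split as (C - 1) q^-k + q^-k to match the form a u + v of
   [abs_summable_lin]. *)
apply: (abs_summable_le hF _ (@abs_summable_lin F hF (C - 1) _ _ sq sq)) => k _.
have -> : ((C - 1) *: (fun k => q ^- k) + (fun k => q ^- k)) k = C * q ^- k.
  by rewrite !fctE -[_ *: _]/(_ * _); ring.
by rewrite [leRHS]ger0_norm//; exact: le_trans (normr_ge0 _) (uC k).
Qed.

Lemma bv0_bounded u : bv0 u -> exists2 C, 0 <= C & forall k, `|u k| <= C.
Proof.
move=> [_ cu]; have /cvg_seq_bounded [M [Mr ub]] : cvgn u by apply/cvg_ex; exists 0.
exists (`|M| + 1); first by rewrite addr_ge0.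
move=> k; apply: ub => //; apply: le_lt_trans (real_ler_norm Mr) _.
by rewrite ltrDl.
Qed.

(** Since z_0 is minus the sum of the other entries, for k >= 1 this is minus the tail of z from
    index k, and so tends to 0. *)
Definition psum z (k : nat) : F := \sum_(0 <= j < k) l1_ext z j.

Definition of_psum S : l1 hF := l1_of hF (fun k => S k.+1 - S k).

Lemma psumS z k : (0 < k)%N -> psum z k.+1 - psum z k = z k.
Proof. by case: k => // k _; rewrite /psum big_nat_recr//= addrAC subrr add0r. Qed.

Lemma psum_bv0 z : bv0 (psum z).
Proof.
split.
  by apply: eq_abs_summable (@l1_summable F hF z) => k k0; rewrite psumS.
rewrite -cvg_shiftS.
have -> : [sequence psum z n.+1]_n
    = (fun n => - sum_from1 z + [series z k.+1]_k n).
  by apply/funext => n; rewrite /= /psum big_nat_recl.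
have cz : [series z k.+1]_k @ \oo --> sum_from1 z.
  exact: (abs_summable_cvg hF (@l1_summable F hF z)).
by have := cvgD (cvg_cst (- sum_from1 z)) cz; rewrite addNr; exact.
Qed.

Lemma psum_lin (a : F) z1 z2 k : psum (a *: z1 + z2) k = a * psum z1 k + psum z2 k.
Proof. exact: sum_l1_ext_lin. Qed.

(** The increments of S telescope to - S_1, so the entry z_0 of [of_psum S] is S_1; adding the
    increments then restores every later value. *)
Lemma of_psumK S k : bv0 S -> (0 < k)%N -> psum (of_psum S) k = S k.
Proof.
move=> [sS cS]; case: k => // k _.
have cs : [series of_psum S k.+1]_k @ \oo --> - S 1%N.
  have -> : [series of_psum S k.+1]_k = (fun n => S n.+1 - S 1%N).
    apply/funext => n; rewrite /series /=.
    rewrite -(telescope_sumr (fun n => S n.+1))//.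
    by apply: eq_bigr => j _; rewrite l1_ofE.
  by rewrite -[X in _ --> X]add0r; apply: cvgB (cvg_cst _); rewrite cvg_shiftS.
elim: k => [|k IH].
  by rewrite /psum big_nat1 /= /sum_from1 (cvg_lim _ cs)// opprK.
by rewrite -[LHS](subrK (psum (of_psum S) k.+1)) psumS// IH l1_ofE// subrK.
Qed.

Lemma psum_inj z1 z2 : (forall k, (0 < k)%N -> psum z1 k = psum z2 k) -> z1 = z2.
Proof. by move=> e; apply: l1_eq => k k0; rewrite -!psumS// !e. Qed.

Lemma l1_norm_le z (M : F) :
  (forall n, \sum_(0 <= k < n) `|z k.+1| <= M) -> `|z| <= M.
Proof.
move=> zM; rewrite l1_normE /sum_from1.
have <- : limn (fun _ : nat => M) = M by exact: lim_cst.
by apply: numfield_limn_le => //; [exact: l1_summable|exact: is_cvg_cst].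
Qed.

(** The norm is the total variation of S, and a telescoping majorant T bounds its partial sums by
    T_1. Later norm estimates reduce to choosing T. *)
Lemma of_psum_norm_le S T : bv0 S -> (forall k, (0 < k)%N -> 0 <= T k) ->
  (forall k, (0 < k)%N -> `|S k.+1 - S k| <= T k - T k.+1) ->
  `|of_psum S| <= T 1%N.
Proof.
move=> [sS _] T0 ST; apply: l1_norm_le => n.
apply: (@le_trans _ _ (\sum_(0 <= k < n) (T k.+1 - T k.+2))).
  by apply: ler_sum => k _; rewrite l1_ofE// ST.
rewrite (telescope_sumr_eq (fun k => - T k.+1))//; last first.
  by move=> k _; rewrite opprK addrC.
by rewrite opprK addrC gerBl T0.
Qed.

(* Truncating the partial sums after the first m keeps the head of z and puts
   a jump of size |psum z m.+1| before the vanishing tail. *)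
Lemma psum_trunc_approx z (e : F) : 0 < e ->
  exists m, `|z - of_psum (fun k => if (k <= m)%N then psum z k else 0)| < e.
Proof.
move=> e0; have e20 : 0 < e / 2 by rewrite divr_gt0.
have [_ cS] := psum_bv0 z.
set A := [series `|z k.+1|]_k.
have cA : A @ \oo --> `|z| by exact: (@l1_summable F hF z).
have Ale n : A n <= `|z|.
  have cAn : (fun m => A (m + n)%N - A n) @ \oo --> `|z| - A n.
    by apply: cvgB (cvg_cst _); rewrite (cvg_shiftn n A).
  rewrite -subr_ge0 -(cvg_lim _ cAn)//; apply: numfield_limn_ge0.
    by apply/cvg_ex; eexists; exact: cAn.
  move=> m; rewrite subr_ge0 /A /series /= (big_cat_nat _ (leq_addl m n))//=.
  by rewrite lerDl sumr_ge0.
have : \forall m \near \oo, `|psum z m.+1| < e / 2 /\ `|z| - A m < e / 2.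
  near=> m; split.
    near: m; have /cvgrPdist_lt/(_ _ e20) : [sequence psum z n.+1]_n @ \oo --> (0 : F).
      by rewrite cvg_shiftS.
    by apply: filterS => m /=; rewrite sub0r normrN.
  rewrite -[ltLHS]ger0_norm ?subr_ge0//.
  by near: m; move/cvgrPdist_lt : cA; exact.
case=> m0 _ /(_ m0 (leqnn _))[h1 h2]; exists m0.
set S := fun k => if (k <= m0)%N then psum z k else 0.
pose R k := if (k <= m0)%N then 0 else psum z k.
have sS : bv0 S.
  have [C C0 SC] := bv0_bounded (psum_bv0 z).
  (* S has finite support, and C 2^m0 2^-k is at least C wherever k <= m0. *)
  apply/abs_summable_bv0/(@geometric_abs_summable _ (C * 2 ^+ m0) 2) => [|k].
    by rewrite ltr1n.
  rewrite /S; case: leqP => km; last first.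
    by rewrite normr0 mulr_ge0 ?mulr_ge0 ?invr_ge0 ?exprn_ge0.
  rewrite -mulrA -exprB ?unitfE ?pnatr_eq0// -[leLHS]mulr1 ler_pM//.
  by rewrite exprn_ege1// ler1n.
have sR : bv0 R.
  apply: eq_bv0 (bv0_lin (-1) sS (psum_bv0 z)) => k _.
  by rewrite !fctE scaleN1r /S /R; case: ifP; rewrite ?addNr// oppr0 add0r.
have -> : z - of_psum S = of_psum R.
  apply: psum_inj => k k0; rewrite addrC -scaleN1r psum_lin !of_psumK//.
  by rewrite /S /R; case: ifP; rewrite mulN1r ?addNr// oppr0 add0r.
(* T_k is the variation of R from index k on: one jump of size |psum z m0.+1| at m0, then the tail
   of the norm of z. When m0 = 0, T_1 consists of the tail only. *)
pose T k := if (k <= m0)%N then `|psum z m0.+1| + (`|z| - A m0) else `|z| - A k.-1.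
apply: le_lt_trans (_ : T 1%N < e).
  apply: of_psum_norm_le => // k k0.
    rewrite /T; case: ifP => _; last by rewrite subr_ge0.
    by apply: addr_ge0 => //; rewrite subr_ge0.
  have AS j : A j.+1 = A j + `|z j.+1| by rewrite /A /series /= big_nat_recr.
  rewrite /R /T; case: (ltngtP k m0) => km.
  - by rewrite !subrr normr0.
  - rewrite psumS// opprB addrC addrA subrK.
    by case: k k0 {km} => // k _; rewrite /= AS addrAC subrr add0r.
  - by rewrite subr0 km /= addrK.
rewrite /T; case: ifP => [_|]; first by rewrite [ltRHS]splitr ltrD.
case: m0 h2 {h1 S R sS sR T} => // h2 _ /=.
by apply: lt_trans h2 _; rewrite ltr_pdivrMr// ltr_pMr// ltr1n.
Unshelve. all: by end_near. Qed.

End partial_sums.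

(** * Backward-shift coordinates *)

Section shift_coordinates.
Context (F : numFieldType) (hF : real_or_complex F) (w : F) (w1 : 1 < `|w|).
Implicit Types (y : nat -> F) (z : l1 hF).
Local Notation A := (hatA hF w).

Definition gauge (k : nat) : F := w ^+ 'C(k, 2).

Definition crd z (k : nat) : F := gauge k * k%:R * psum z k.

Definition vec y : l1 hF := of_psum hF (fun k => y k / (gauge k * k%:R)).

(** The n-th condition says that y shifted by n is again the coordinate sequence of an l_1 vector;
    together they put [vec y] in the domain of every power. *)
Definition admissible y : Prop :=
  forall n, bv0 (fun k => y (k + n)%N / (gauge k * k%:R)).

Lemma base_neq0 : w != 0.
Proof. by rewrite -normr_gt0 (lt_trans ltr01). Qed.

Lemma gauge_neq0 k : gauge k != 0.
Proof. exact: expf_neq0 base_neq0. Qed.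

Lemma gaugeS k : gauge k.+1 = gauge k * w ^+ k.
Proof. by rewrite /gauge binS bin1 exprD. Qed.

Lemma gauge_prod k n : \prod_(k <= m < k + n) w ^+ m = gauge (k + n) / gauge k.
Proof.
elim: n => [|n IH]; first by rewrite addn0 big_geq// divff// gauge_neq0.
by rewrite addnS big_nat_recr ?leq_addr//= IH gaugeS mulrAC.
Qed.

Lemma weight_neq0 k : (0 < k)%N -> gauge k * k%:R != 0.
Proof. by move=> k0; rewrite mulf_neq0 ?gauge_neq0// pnatr_eq0 -lt0n. Qed.

Lemma weight_bound (r : F) : 0 <= r -> exists2 C : F, 0 <= C &
  forall k, r ^+ k / `|gauge k * k%:R| <= C * 2 ^- k.
Proof.
(* Dominating (2r)^k instead of r^k leaves the factor 2^-k. At index 0 the weight is 0, and so is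
   its inverse. *)
move=> r0; have [|C C0 rC] := gauge_dominates hF (r := r * 2) w1.
  by rewrite mulr_ge0.
exists C => //; case=> [|k].
  by rewrite mulr0 normr0 invr0 mulr0 mulr_ge0// invr_ge0.
have g0 : 0 < `|gauge k.+1| by rewrite normr_gt0 gauge_neq0.
rewrite normrM normr_nat invfM mulrA.
apply: (@le_trans _ _ (r ^+ k.+1 / `|gauge k.+1|)).
  rewrite -[leRHS]mulr1 ler_wpM2l ?divr_ge0 ?exprn_ge0//.
  by rewrite invf_le1 ?ltr0n// ler1n.
rewrite ler_pdivrMr// mulrAC ler_pdivlMr ?exprn_gt0//.
by rewrite -exprMn rC.
Qed.

(** Each shift of y still has growth rate r, and dividing by the weight leaves a multiple of the
    summable sequence 2^-k. *)
Lemma admissible_le y (C r : F) : 0 <= r -> (forall k, `|y k| <= C * r ^+ k) ->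
  admissible y.
Proof.
move=> r0 yC n; have [M M0 rM] := weight_bound r0.
have C0 : 0 <= C by have := yC 0%N; rewrite expr0 mulr1; exact: le_trans.
apply: (abs_summable_bv0 hF).
apply: (@geometric_abs_summable _ hF _ (C * r ^+ n * M) 2); first by rewrite ltr1n.
move=> k; rewrite normrM normfV.
apply: le_trans (ler_wpM2r _ (yC _)) _; first by rewrite invr_ge0.
by rewrite addnC exprD -!mulrA ler_wpM2l// ler_wpM2l ?exprn_ge0.
Qed.

Lemma admissible_lin (a : F) y1 y2 : admissible y1 -> admissible y2 ->
  admissible (a *: y1 + y2).
Proof.
move=> h1 h2 n; apply: (eq_bv0 hF) (bv0_lin hF a (h1 n) (h2 n)) => k _.
by rewrite !fctE scalerAl -mulrDl.
Qed.

Lemma admissible_shift y n : admissible y -> admissible (fun k => y (k + n)%N).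
Proof.
move=> hy m; apply: (eq_bv0 hF) (hy (m + n)%N) => k _.
by rewrite addnA.
Qed.

Lemma crd_inj z1 z2 : (forall k, (0 < k)%N -> crd z1 k = crd z2 k) -> z1 = z2.
Proof.
move=> e; apply: psum_inj => k k0.
by apply: (mulfI (weight_neq0 k0)); exact: e.
Qed.

Lemma crd_lin (a : F) z1 z2 k : crd (a *: z1 + z2) k = a * crd z1 k + crd z2 k.
Proof. by rewrite /crd psum_lin mulrDr mulrCA. Qed.

Lemma crd0 k : crd 0 k = 0.
Proof. by have := crd_lin (-1) 0 0 k; rewrite scaler0 addr0 mulN1r addNr. Qed.

Lemma crdZ (a : F) z k : crd (a *: z) k = a * crd z k.
Proof. by rewrite -[_ *: _]addr0 crd_lin crd0 addr0. Qed.

Lemma psum_crd z k : (0 < k)%N -> psum z k = crd z k / (gauge k * k%:R).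
Proof. by move=> k0; rewrite /crd mulrC mulKf// weight_neq0. Qed.

Lemma vecK y k : admissible y -> (0 < k)%N -> crd (vec y) k = y k.
Proof.
move=> hy k0; rewrite /crd of_psumK//; last first.
  by apply: (eq_bv0 hF) (hy 0%N) => j _; rewrite addn0.
by rewrite mulrC divfK// weight_neq0.
Qed.

Lemma vecB y1 y2 : admissible y1 -> admissible y2 ->
  vec y1 - vec y2 = vec (fun k => y1 k - y2 k).
Proof.
move=> h1 h2.
have e : (fun k => y1 k - y2 k) = (-1) *: y2 + y1.
  by apply/funext => k; rewrite !fctE scaleN1r addrC.
rewrite e addrC -scaleN1r; apply: crd_inj => k k0.
rewrite crd_lin !vecK//; exact: admissible_lin.
Qed.

(** This is the estimate behind all approximations: S_k is of order B 2^-k, so sequences agreeing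
    below N give vectors at distance of order 2^-N, with K independent of y, N and B. *)
Lemma vec_norm_le : exists2 K : F, 0 <= K & forall y (N : nat) (B : F),
  (forall k, (0 < k < N)%N -> y k = 0) -> (forall k, `|y k| <= B * 2 ^+ k) ->
  `|vec y| <= K * B * 2 ^- N.
Proof.
have [C C0 rC] := @weight_bound 2 (ler0n _ _).
exists (8 * C) => [|y N B y0 yB]; first by rewrite mulr_ge0.
have B0 : 0 <= B by have := yB 0%N; rewrite expr0 mulr1; exact: le_trans.
have hy : admissible y := admissible_le (ler0n _ _) yB.
set S := fun k => y k / (gauge k * k%:R).
have bS : bv0 S by apply: (eq_bv0 hF) (hy 0%N) => k _; rewrite addn0.
have S_le k : `|S k| <= B * C * 2 ^- k.
  rewrite /S normrM normfV; apply: le_trans (ler_wpM2r _ (yB _)) _.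
    by rewrite invr_ge0.
  by rewrite -!mulrA ler_wpM2l.
have inv2 k : 0 <= 2 ^- k :> F by rewrite invr_ge0 exprn_ge0.
(* T stays constant while S_k and S_(k+1) both vanish. From k + 1 >= N on it drops by 2 B C 2^-k,
   more than the bound 3/2 B C 2^-k for |S_(k+1)| + |S_k|. *)
pose T k := 8 * (B * C) * 2 ^- maxn k.+1 N.
apply: (@le_trans _ _ (T 1%N)).
  apply: of_psum_norm_le => // k k0; first by rewrite /T !mulr_ge0.
  rewrite /T; have [kN|kN] := ltnP k.+1 N.
    rewrite /S !y0 ?k0 ?(ltnW kN)// !mul0r subrr normr0.
    by rewrite (maxn_idPr kN) subrr.
  rewrite (maxn_idPl (leqW kN)).
  apply: le_trans (ler_normB _ _) _; apply: le_trans (lerD (S_le _) (S_le _)) _.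
  rewrite -subr_ge0.
  have -> : 8 * (B * C) / 2 ^+ k.+1 - 8 * (B * C) / 2 ^+ k.+2
      - (B * C / 2 ^+ k.+1 + B * C / 2 ^+ k) = B * C / 2 ^+ k.+1.
    by rewrite !exprS; field; rewrite ?expf_neq0.
  by rewrite !mulr_ge0.
rewrite /T -!mulrA ler_wpM2l// mulrCA ler_wpM2l// ler_wpM2l//.
rewrite lef_pV2 ?posrE ?exprn_gt0//.
by apply: ler_weXn2l; rewrite ?ler1n// leq_maxr.
Qed.

(** * The operator and the domains of its powers in shift coordinates *)

Lemma hatA_domE z : dom A z <-> bv0 (fun k => crd z k.+1 / (gauge k * k%:R)).
Proof.
apply: iff_trans (space_X_bv0 _) _.
have e k : (0 < k)%N -> w ^+ k * k.+1%:R * (\sum_(0 <= j < k.+1) l1_ext z j) / k%:R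
    = crd z k.+1 / (gauge k * k%:R).
  move=> k0; rewrite /crd gaugeS /psum; field.
  by rewrite gauge_neq0 pnatr_eq0 -lt0n k0.
by split; apply: (eq_bv0 hF) => k k0; rewrite e.
Qed.

(** The two terms of [hatA_seq] are consecutive values of the sequence in [hatA_domE]. That sequence
    has the shifted coordinates over the weight because gauge (k+1) = gauge k w^k. *)
Lemma hatA_of_psum z : dom A z ->
  A z = of_psum hF (fun k => crd z k.+1 / (gauge k * k%:R)).
Proof.
move=> dz; apply: l1_eq => k k0; rewrite [LHS]hatA_funE// l1_ofE//; last first.
  by have /hatA_domE[] := dz.
rewrite /hatA_seq /crd !gaugeS /psum; field.
by rewrite gauge_neq0 expf_neq0 ?base_neq0// nat1r !pnatr_eq0 -lt0n k0.
Qed.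

Lemma crd_hatA z k : dom A z -> (0 < k)%N -> crd (A z) k = crd z k.+1.
Proof.
move=> dz k0; have bS := (hatA_domE z).1 dz.
rewrite {1}/crd hatA_of_psum// (of_psumK hF bS k0).
by rewrite mulrC divfK// weight_neq0.
Qed.

Lemma crd_iter n z k : pow_dom A n z -> (0 < k)%N ->
  crd (iter n A z) k = crd z (k + n).
Proof.
elim: n k => [|n IH] k /=; first by rewrite addn0.
by move=> [pz dz] k0; rewrite crd_hatA// IH// addnS.
Qed.

(* Passing from n+1 to n divides the sequence by w^k, so for |w| > 1 a bounded
   sequence at level n+1 yields an absolutely summable one at level n. *)
Lemma bv0_crd_pred n z : bv0 (fun k => crd z (k + n.+1)%N / (gauge k * k%:R)) ->
  bv0 (fun k => crd z (k + n)%N / (gauge k * k%:R)).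
Proof.
move=> /bv0_bounded[C C0 zC].
have w0 : 0 < `|w| := lt_trans ltr01 w1.
(* The entry at k + 2 is bounded through the hypothesis at k + 1, which costs an extra factor |w| on
   C; D covers index 1. *)
pose D := `|crd z (1 + n) / (gauge 1 * 1%:R)| * `|w|.
have D0 : 0 <= D by rewrite mulr_ge0// ltW.
apply: (abs_summable_bv0 hF).
apply: (@geometric_abs_summable _ hF _ (C * `|w| + D) `|w|) => // -[|[|k]].
- rewrite mulr0 invr0 mulr0 normr0.
  by rewrite mulr_ge0 ?addr_ge0 ?mulr_ge0 ?invr_ge0 ?exprn_ge0// ltW.
- rewrite expr1 mulrDl !mulfK ?gt_eqF//.
  by rewrite lerDr.
- rewrite mulrDl ler_wpDr ?divr_ge0 ?exprn_ge0 ?(ltW w0)//.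
  rewrite exprS [X in _ <= _ * X]invfM [X in _ <= X]mulrA mulfK ?gt_eqF//.
  rewrite ler_pdivlMr ?exprn_gt0// -normrX -normrM.
  apply: le_trans (zC k.+1); rewrite -addSnnS.
  set c := crd z _; rewrite gaugeS.
  have -> : c / (gauge k.+1 * w ^+ k.+1 * k.+2%:R) * w ^+ k.+1
     = c / (gauge k.+1 * k.+1%:R) * (k.+1%:R / k.+2%:R).
    field; by rewrite gauge_neq0 nat1r -natrD !pnatr_eq0 expf_neq0 ?base_neq0.
  rewrite normrM -[leRHS]mulr1 ler_wpM2l//.
  by rewrite ger0_norm ?divr_ge0// ler_pdivrMr ?ltr0n// mul1r ler_nat.
Qed.

(** The natural domain imposes a condition at every level from 1 to n; by [bv0_crd_pred] the one at
    level n implies the others. *)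
Lemma pow_domE n z : (0 < n)%N ->
  pow_dom A n z <-> bv0 (fun k => crd z (k + n)%N / (gauge k * k%:R)).
Proof.
have step m : pow_dom A m z ->
    dom A (iter m A z) <-> bv0 (fun k => crd z (k + m.+1)%N / (gauge k * k%:R)).
  move=> pz; apply: iff_trans (hatA_domE _) _.
  by split; apply: (eq_bv0 hF) => k k0; rewrite crd_iter// addSnnS.
case: n => // n _; elim: n => [|n IH].
  by split=> [[_ /step]|]; [apply|move=> h; split=> //; exact/step].
split=> [[pz /step]|h]; first by apply.
have pz : pow_dom A n.+1 z by apply/IH; exact: bv0_crd_pred.
by split=> //; exact/step.
Qed.

Lemma vec_pow_dom y n : admissible y -> pow_dom A n (vec y).
Proof.
case: n => // n hy; apply/pow_domE => //.
by apply: (eq_bv0 hF) (hy n.+1) => k k0; rewrite vecK// addnS.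
Qed.

Lemma iter_vec y n : admissible y -> iter n A (vec y) = vec (fun k => y (k + n)%N).
Proof.
move=> hy; apply: crd_inj => k k0.
rewrite crd_iter//; last exact: vec_pow_dom.
by rewrite !vecK ?addn_gt0 ?k0//; exact: admissible_shift.
Qed.

End shift_coordinates.

(** * Chaos of the powers *)

Lemma dense_approx (F : numFieldType) (E : normedModType F) (S : set E) :
  (forall (z : E) (e : F), 0 < e -> exists2 p, S p & `|z - p| < e) -> dense S.
Proof.
move=> SE O [z Oz] oO; have : nbhs z O by rewrite nbhsE; exists O.
rewrite -nbhs_ballE => -[e /= e0 zeO].
have [p Sp zp] := SE z e e0.
by exists p; split=> //; apply: zeO; rewrite -ball_normE.
Qed.

Lemma seq_bounded (F : numFieldType) (s : seq F) :
  exists2 M : F, 0 <= M & forall k, `|nth 0 s k| <= M.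
Proof.
elim: s => [|x s [M M0 sM]]; first by exists 0 => // k; rewrite nth_nil normr0.
exists (`|x| + M); first by rewrite addr_ge0.
by case=> [|k] /=; rewrite ?lerDl// (le_trans (sM k))// lerDr.
Qed.

Lemma trunc_log_le p n : (trunc_log p n <= n)%N.
Proof.
have [p1|p1] := leqP p 1; first by rewrite /trunc_log; case: p p1 => [|[]].
case: n => [|n]; first by rewrite trunc_log0.
have /andP[h _] := trunc_log_bounds p1 (ltn0Sn n).
exact: leq_trans (ltnW (ltn_expl _ p1)) h.
Qed.

Section dynamics.
Context (F : numFieldType) (hF : real_or_complex F) (w : F) (w1 : 1 < `|w|).
Local Notation A := (hatA hF w).
Local Notation vec := (vec hF w).
Local Notation admissible := (@admissible F w).

Lemma admissible_bounded (y : nat -> F) (M : F) :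
  (forall k, `|y k| <= M) -> admissible y.
Proof.
by move=> yM; apply: (admissible_le hF w1 (C := M) ler01) => k; rewrite expr1n mulr1.
Qed.

Lemma admissible_seq (s : seq F) : admissible (nth 0 s).
Proof. by have [M _] := seq_bounded s; exact: admissible_bounded. Qed.

(** Truncating the partial sums of z leaves finitely many nonzero coordinates, each of which is then
    replaced by a nearby value of d. *)
Lemma vec_seq_approx (d : nat -> F) (z : l1 hF) (e : F) :
  (forall x e' : F, 0 < e' -> exists n, `|x - d n| < e') -> 0 < e ->
  exists s : seq nat, `|z - vec (nth 0 (map d s))| < e.
Proof.
move=> dd e0; have e20 : 0 < e / 2 by rewrite divr_gt0.
have [K K0 vK] := vec_norm_le hF w1.
have [m zm] := psum_trunc_approx z e20.
(* Chosen so that K h < e / 2; the summand 1 keeps the denominator positive when K = 0. *)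
pose h := e / 2 / (K + 1).
have h0 : 0 < h by rewrite divr_gt0// ltr_wpDl.
have [f zf] := choice (fun k => dd (crd w z k) h h0).
exists (mkseq f m.+1).
pose y k := if (k <= m)%N then crd w z k else 0.
have yE : of_psum hF (fun k => if (k <= m)%N then psum z k else 0) = vec y.
  congr of_psum; apply/funext => -[|k]; rewrite /y.
    by rewrite /= /psum big_geq// mulr0 invr0 mulr0.
  by case: ifP => _; rewrite ?mul0r// (psum_crd w1).
have ay : admissible y.
  have -> : y = nth 0 (mkseq (crd w z) m.+1).
    apply/funext => k; rewrite /y; case: leqP => km; first by rewrite nth_mkseq.
    by rewrite nth_default// size_mkseq.
  exact: admissible_seq.
rewrite -(subrK (vec y) z) -addrA (le_lt_trans (ler_normD _ _))//.
rewrite [ltRHS]splitr; apply: ltrD; first by rewrite -yE.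
rewrite (vecB hF w1 ay (admissible_seq _)).
apply: le_lt_trans (_ : K * h * 2 ^- 0 < _).
  apply: vK => k; first by rewrite ltn0 andbF.
  apply: (@le_trans _ _ h); last first.
    by rewrite -[leLHS]mulr1 ler_wpM2l ?(ltW h0)// exprn_ege1// ler1n.
  rewrite /y; case: leqP => km.
    by rewrite (nth_map 0%N) ?size_mkseq// nth_mkseq// ltW.
  rewrite nth_default; first by rewrite subrr normr0 ltW.
  by rewrite size_map size_mkseq.
rewrite expr0 invr1 mulr1 /h mulrCA -[ltRHS]mulr1 ltr_pM2l//.
by rewrite ltr_pdivrMr ?mul1r ?ltrDl// ltr_wpDl.
Qed.

(** * Chaos of an operator B acting as the n-th power: A itself for n = 1, or [op_pow A n] *)

Section power.
Context (n : nat) (n0 : (0 < n)%N) (B : lin_op (l1 hF)).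
Context (BE : forall z, B z = iter n A z).
Context (Bdom : forall y, admissible y -> dom B (vec y)).

Lemma iter_power j z : iter j B z = iter (j * n) A z.
Proof. by rewrite iterM; apply: eq_iter. Qed.

Lemma vec_power_dom j y : admissible y -> pow_dom B j (vec y).
Proof.
move=> hy; elim: j => //= j IH; split=> //.
rewrite iter_power (iter_vec hF w1)//; apply: Bdom.
exact: (admissible_shift hF).
Qed.

(** Repeating the first N entries of t with period N gives a point fixed by B^N, which shifts by the
    multiple N n of the period. It agrees with t below N, so its distance to [vec t] is of order
    2^-N. *)
Lemma power_periodic_dense : dense (periodic_points B).
Proof.
apply: dense_approx => z e e0; have e20 : 0 < e / 2 by rewrite divr_gt0.
have [d dd] := scalar_separable hF.
have [s zs] := vec_seq_approx z dd e20.
set t := nth 0 (map d s) in zs *; have at_ : admissible t := admissible_seq _.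
have [M M0 tM] : exists2 M : F, 0 <= M & forall k, `|t k| <= M := seq_bounded _.
have [K K0 vK] := vec_norm_le hF w1.
have h0 : 0 < e / 2 / (K * (2 * M) + 1).
  by rewrite divr_gt0// ltr_wpDl// !mulr_ge0.
have [n1 small] := exprV_small hF (ltr1n F 2) h0.
pose N := (maxn n1 (size s)).+1.
pose y k := t (k %% N)%N.
have ay : admissible y by apply: (@admissible_bounded _ M) => k; exact: tM.
exists (vec y).
  exists N; split=> //; first exact: vec_power_dom.
  rewrite -[LHS]/(iter N B (vec y)) iter_power (iter_vec hF w1)//; congr vec.
  by apply/funext => k; rewrite /y addnC mulnC modnMDl.
rewrite -(subrK (vec t) z) -addrA (le_lt_trans (ler_normD _ _))//.
rewrite [ltRHS]splitr; apply: ltrD; first exact: zs.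
rewrite (vecB hF w1 at_ ay); apply: le_lt_trans (_ : K * (2 * M) * 2 ^- N < _).
  apply: vK => k.
    by move=> /andP[_ kN]; rewrite /y modn_small// subrr.
  apply: le_trans (ler_normB _ _) _.
  apply: (@le_trans _ _ (2 * M)); first by rewrite mulr_natl mulr2n lerD// tM.
  by rewrite -[leLHS]mulr1 ler_wpM2l ?mulr_ge0// exprn_ege1// ler1n.
have h : 2 ^- N < e / 2 / (K * (2 * M) + 1) by apply: small; rewrite ltnW// ltnS leq_maxl.
rewrite ltr_pdivlMr in h; last by rewrite ltr_wpDl// !mulr_ge0.
apply: le_lt_trans h.
by rewrite mulrC ler_wpM2l ?lerDl ?invr_ge0 ?exprn_ge0.
Qed.

(* Each finite sequence is listed infinitely often (as logn 2 i takes every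
   value infinitely often); capping the entries at i.+1 controls the growth. *)
Definition target (d : nat -> F) (i k : nat) : F :=
  let v := nth 0 (map d (odflt [::] (unpickle (logn 2 i)))) k in
  if `|v| <= i.+1%:R then v else 0.

(* The block of length n * 2 ^ i starting at n * 2 ^ i is the i-th target. *)
Definition universal (d : nat -> F) (m : nat) : F :=
  let i := trunc_log 2 (m %/ n) in target d i (m - 2 ^ i * n).

Lemma target_le d i k : `|target d i k| <= i.+1%:R.
Proof. by rewrite /target; case: ifP => //; rewrite normr0. Qed.

Lemma target_hits d (s : seq nat) (m : nat) :
  exists2 i, (m <= i)%N & target d i = nth 0 (map d s).
Proof.
have [M M0 sM] := seq_bounded (map d s).
have [m' Mm'] := scalar_archi hF M.
(* The odd factor leaves the 2-adic valuation equal to [pickle s]; its size gives i >= m and lifts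
   the cap above M < m'. *)
pose i := (2 ^ pickle s * (m + m').*2.+1)%N.
have mi : (m + m' <= i)%N.
  apply: leq_trans (leq_pmull _ _); last by rewrite expn_gt0.
  by rewrite -addnn -addnS leq_addr.
have li : logn 2 i = pickle s.
  by rewrite lognM ?expn_gt0// pfactorK// logn_coprime ?addn0// coprime2n /= odd_double.
exists i; first exact: leq_trans (leq_addr _ _) mi.
apply/funext => k; rewrite /target li pickleK /= ifT//.
apply: le_trans (sM k) _; rewrite -(ger0_norm M0); apply: le_trans (ltW Mm') _.
by rewrite ler_nat; apply: leqW; exact: leq_trans (leq_addl _ _) mi.
Qed.

Lemma universal_le d m : `|universal d m| <= m.+1%:R.
Proof.
apply: le_trans (target_le _ _ _) _; rewrite ler_nat ltnS.
exact: leq_trans (trunc_log_le _ _) (leq_div _ _).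
Qed.

Lemma universal_block d i k : (k < 2 ^ i * n)%N ->
  universal d (k + 2 ^ i * n) = target d i k.
Proof.
move=> ki; rewrite /universal.
have -> : trunc_log 2 ((k + 2 ^ i * n) %/ n) = i.
  (* For k < 2^i n the quotient of k + 2^i n by n lies in [2^i, 2^(i+1)). *)
  apply: trunc_log_eq => //; rewrite addnC divnMDl// leq_addr/=.
  by rewrite expnS mul2n -addnn ltn_add2l ltn_divLR.
by rewrite addnK.
Qed.

(** B^(2^i) shifts by N = 2^i n, exactly to the start of the i-th block, so the image of [vec u]
    shares its coordinates below N with the i-th target. Linear growth of u makes the remainder of
    order 2^-N. *)
Lemma power_hypercyclic : hypercyclic B.
Proof.
have [d dd] := scalar_separable hF.
set u := universal d.
have expn2 k : k.+1%:R <= 2 ^+ k :> F by rewrite -natrX ler_nat ltn_expl.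
have au : admissible u.
  apply: (admissible_le hF w1 (C := 1) (ler0n _ 2)) => k.
  by rewrite mul1r (le_trans (universal_le _ _)).
have du : dense (range (fun j => op_pow B j (vec u))).
  apply: dense_approx => z e e0; have e20 : 0 < e / 2 by rewrite divr_gt0.
  have [s zs] := vec_seq_approx z dd e20.
  have [K K0 vK] := vec_norm_le hF w1.
  have h0 : 0 < e / 2 / (K * 4 + 1) by rewrite divr_gt0// ltr_wpDl// mulr_ge0.
  have [n1 small] := exprV_small hF (ltr1n F 2) h0.
  have [i n1i ti] := target_hits d s n1.
  pose N := (2 ^ i * n)%N.
  have iN : (i < N)%N.
    by apply: leq_trans (ltn_expl i (ltnSn 1)) _; rewrite leq_pmulr.
  exists (iter (2 ^ i) B (vec u)); first by exists (2 ^ i)%N.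
  rewrite iter_power (iter_vec hF w1)// -ti in zs *.
  set t := target d i in zs *.
  have at_ : admissible t by rewrite /t ti; exact: admissible_seq.
  rewrite -(subrK (vec t) z) -addrA (le_lt_trans (ler_normD _ _))//.
  rewrite [ltRHS]splitr; apply: ltrD; first exact: zs.
  rewrite (vecB hF w1 at_ (admissible_shift hF (2 ^ i * n) au)).
  apply: le_lt_trans (_ : K * 4 * 2 ^- N < _).
    have low k : (k < N)%N -> t k - u (k + 2 ^ i * n)%N = 0.
      by move=> kN; rewrite /u universal_block// subrr.
    apply: vK => k; first by move=> /andP[_]; exact: low.
    have [kN|Nk] := ltnP k N; first by rewrite low// normr0 mulr_ge0// exprn_ge0.
    apply: le_trans (ler_normB _ _) _.
    apply: le_trans (lerD (target_le _ _ _) (universal_le _ _)) _.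
    (* As i < N <= k, the sum of the bounds i + 1 and k + N + 1 is at most 4 (k + 1). *)
    apply: (@le_trans _ _ (4 * k.+1%:R)); last by rewrite ler_wpM2l.
    by rewrite -natrD -natrM ler_nat; move: iN Nk; rewrite /N; lia.
  have h : 2 ^- N < e / 2 / (K * 4 + 1).
    by apply: small; exact: leq_trans n1i (ltnW iN).
  rewrite ltr_pdivlMr in h; last by rewrite ltr_wpDl// mulr_ge0.
  apply: le_lt_trans h.
  by rewrite mulrC ler_wpM2l ?lerDl ?invr_ge0 ?exprn_ge0.
exists (vec u); split=> //; last by move=> j _; exact: vec_power_dom.
(* If [vec u] were 0, its whole orbit would be 0 and would miss the ball of radius |c| around a
   nonzero c. *)
apply/eqP => u0.
pose c := vec (fun=> 1).
have a1 : admissible (fun=> 1) by apply: (@admissible_bounded _ 1) => k; rewrite normr1.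
have c0 : 0 < `|c|.
  rewrite normr_gt0; apply/eqP => c0; have := vecK hF w1 a1 (ltn0Sn 0).
  by rewrite -/c c0 crd0 => /eqP; rewrite eq_sym oner_eq0.
have [|p [cp [j _ jp]]] := du (ball c `|c|) _ (ball_open c `|c|).
  by exists c; exact: ballxx.
have {}jp : p = 0 by rewrite -jp u0; exact: (pow0 B j).2.
by move: cp; rewrite -ball_normE /= jp subr0 ltxx.
Qed.

Lemma power_chaotic : chaotic B.
Proof. by split; [exact: power_hypercyclic|exact: power_periodic_dense]. Qed.

End power.
End dynamics.

(** * Eigenvectors and unboundedness *)

Section spectrum.
Context (F : numFieldType) (hF : real_or_complex F) (w : F) (w1 : 1 < `|w|).
Local Notation A := (hatA hF w).

Definition eigenvec (lambda : F) : l1 hF := vec hF w (fun k => lambda ^+ k.-1).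

Lemma admissible_eigen (lambda : F) : admissible w (fun k => lambda ^+ k.-1).
Proof.
(* The rate 1 + |lambda| is at least 1, so the exponent k - 1 may be raised to k. *)
apply: (admissible_le hF w1 (C := 1) (r := 1 + `|lambda|)) => [|k].
  by rewrite addr_ge0.
rewrite mul1r normrX; apply: (@le_trans _ _ ((1 + `|lambda|) ^+ k.-1)).
  by apply: lerXn2r; rewrite ?nnegrE ?addr_ge0// lerDr.
by apply: ler_weXn2l; rewrite ?lerDl ?leq_pred.
Qed.

Lemma crd_eigenvec lambda k : (0 < k)%N -> crd w (eigenvec lambda) k = lambda ^+ k.-1.
Proof. by move=> k0; rewrite vecK//; exact: admissible_eigen. Qed.

Lemma dom_eigenvec n lambda : pow_dom A n (eigenvec lambda).
Proof. by apply: (vec_pow_dom hF w1); exact: admissible_eigen. Qed.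

Lemma iter_eigenvec n lambda : iter n A (eigenvec lambda) = lambda ^+ n *: eigenvec lambda.
Proof.
apply: (crd_inj w1) => k k0; rewrite crd_iter//; last exact: dom_eigenvec.
rewrite crdZ !crd_eigenvec ?addn_gt0 ?k0//.
by rewrite -exprD addnC -!subn1 addnBA.
Qed.

Lemma eigenvec_neq0 lambda : eigenvec lambda != 0.
Proof.
apply/eqP => e0; have := crd_eigenvec lambda (ltn0Sn 0).
by rewrite e0 crd0 => /eqP; rewrite eq_sym oner_eq0.
Qed.

Lemma eigenvec_ker lambda : op_ker (op_shift A lambda) (eigenvec lambda).
Proof.
split; first exact: (dom_eigenvec 1 lambda).2.
rewrite -[LHS]/(iter 1 A (eigenvec lambda) - lambda *: eigenvec lambda).
by rewrite iter_eigenvec expr1 subrr.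
Qed.

(** The eigenvalue equation makes each coordinate lambda times the preceding one, so the first
    coordinate determines z. *)
Lemma ker_eigenvec lambda z : op_ker (op_shift A lambda) z ->
  z = crd w z 1 *: eigenvec lambda.
Proof.
move=> [dz kz]; have Az : A z = lambda *: z by exact: subr0_eq kz.
apply: (crd_inj w1) => -[//|k] _.
rewrite crdZ crd_eigenvec//=.
elim: k => [|k IH]; first by rewrite expr0 mulr1.
by rewrite -(crd_hatA w1)// Az crdZ IH exprS mulrCA.
Qed.

Lemma hatA_ker_dim lambda : has_dim (op_ker (op_shift A lambda)) 1.
Proof.
exists (fun=> eigenvec lambda); split.
  move=> c; rewrite big_ord1 => /eqP.
  rewrite scaler_eq0 (negbTE (eigenvec_neq0 _)) orbF => /eqP c0 i.
  by rewrite (ord1 i).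
apply/seteqP; split=> [z hz|z [c _ <-]].
  by exists (fun=> crd w z 1) => //; rewrite big_ord1 -ker_eigenvec.
rewrite big_ord1 -[_ *: _]addr0.
have [d k] := eigenvec_ker lambda.
split; first exact: (dom_lin _ d (dom0 (op_shift A lambda))).
rewrite op_lin//; last exact: dom0.
by rewrite k scaler0 add0r; exact: (pow0 (op_shift A lambda) 1).2.
Qed.

Lemma hatA_point_spectrum : point_spectrum A = [set: F].
Proof.
apply/seteqP; split=> // lambda _ inj.
have [d k] := eigenvec_ker lambda.
have /eqP[] := eigenvec_neq0 lambda; apply: inj; rewrite ?inE//.
  exact: dom0.
by rewrite k; apply/esym; exact: (pow0 (op_shift A lambda) 1).2.
Qed.

(** B multiplies [eigenvec lambda] by lambda^n, and lambda = m + 1 with m > |M| defeats the bound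
    M. *)
Lemma hatA_power_unbounded n (B : lin_op (l1 hF)) : (0 < n)%N ->
  (forall z, B z = iter n A z) -> (forall lambda, dom B (eigenvec lambda)) ->
  unbounded_op B.
Proof.
move=> n0 BE Bd [M hM]; have [m Mm] := scalar_archi hF M.
have := hM _ (Bd m.+1%:R); rewrite BE iter_eigenvec normrZ normrX normr_nat.
rewrite ler_pM2r ?normr_gt0 ?eigenvec_neq0// => mM.
have M0 : 0 <= M by apply: le_trans mM; rewrite exprn_ge0.
move: Mm; rewrite ger0_norm// => /(le_lt_trans mM).
rewrite -natrX ltr_nat ltnNge => /negP; apply.
by apply: (leq_trans (leqnSn m)); rewrite -[leqLHS]expn1 leq_pexp2l.
Qed.

(** * Explicit entries and domains of the powers *)

Lemma hatA_pow_seq n z k : (0 < k)%N -> pow_dom A n z ->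
  iter n A z k = (\prod_(k <= m < k + n) w ^+ m)
    * (w ^+ n * ((k + 1 + n)%:R / (k + 1)%:R) * psum z (k + n).+1
       - (k + n)%:R / k%:R * psum z (k + n)).
Proof.
move=> k0 pz; rewrite -psumS//.
have e j : (0 < j)%N ->
    psum (iter n A z) j = crd w z (j + n) / (gauge w j * j%:R).
  by move=> j0; rewrite (psum_crd w1)// crd_iter.
rewrite !e// (gauge_prod w1) /crd addSn addn1 !(gaugeS w) exprD.
field.
by rewrite nat1r !pnatr_eq0 -lt0n k0 gauge_neq0 ?expf_neq0 ?(base_neq0 w1).
Qed.

Lemma hatA_pow_domE n : (0 < n)%N ->
  pow_dom A n = [set z : l1 hF | space_X F (fun k =>
    (\prod_(k <= m < k + n) w ^+ m) * (k + n)%:R * psum z (k + n))].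
Proof.
move=> n0; apply/seteqP.
have e (z : l1 hF) k : (0 < k)%N ->
   (\prod_(k <= m < k + n) w ^+ m) * (k + n)%:R * psum z (k + n) / k%:R
   = crd w z (k + n) / (gauge w k * k%:R).
  move=> k0; rewrite (gauge_prod w1) /crd; field.
  by rewrite gauge_neq0// pnatr_eq0 -lt0n k0.
by split=> z; [move/(pow_domE w1 _ n0)|move=> h; apply/(pow_domE w1 _ n0); move: h];
  apply: (eq_bv0 hF) => k k0; rewrite e.
Qed.

End spectrum.

Theorem theorem6p4 (F : numFieldType) (hF : real_or_complex F)
    (w : F) (hw : 1 < `|w|) :
  [/\ unbounded_op (hatA hF w) /\ chaotic (hatA hF w),
      forall n : nat, (0 < n)%N ->
        [/\ dom (op_pow (hatA hF w) n) =
              [set z : l1 hF | space_X F (fun k =>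
                (\prod_(k <= m < k + n) w ^+ m) * (k + n)%:R
                * \sum_(0 <= j < k + n) l1_ext z j)],
            forall z : l1 hF, dom (op_pow (hatA hF w) n) z ->
              forall k : nat, (0 < k)%N ->
                op_pow (hatA hF w) n z k =
                (\prod_(k <= m < k + n) w ^+ m)
                * (w ^+ n * ((k + 1 + n)%:R / (k + 1)%:R)
                     * (\sum_(0 <= j < (k + n).+1) l1_ext z j)
                   - (k + n)%:R / k%:R
                     * (\sum_(0 <= j < k + n) l1_ext z j)),
            unbounded_op (op_pow (hatA hF w) n)
          & chaotic (op_pow (hatA hF w) n)],
      forall lambda : F, has_dim (op_ker (op_shift (hatA hF w) lambda)) 1
    & is_complex_field F -> point_spectrum (hatA hF w) = [set: F]].
Proof.
split; last by move=> _; exact: hatA_point_spectrum.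
- split.
    apply: (hatA_power_unbounded hw (ltn0Sn 0)) => // lambda.
    exact: (dom_eigenvec hF hw 1 lambda).2.
  apply: (power_chaotic hw (ltn0Sn 0)) => // y hy.
  exact: (vec_pow_dom hF hw 1 hy).2.
- move=> n n0; split.
  + exact: hatA_pow_domE.
  + by move=> z dz k k0; exact: hatA_pow_seq.
  + apply: (hatA_power_unbounded hw n0) => // lambda.
    exact: dom_eigenvec.
  + apply: (power_chaotic hw n0) => // y hy.
    exact: vec_pow_dom.
- by move=> lambda; exact: hatA_ker_dim.
Qed.
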